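(* Let $(X,d)$ be a nonempty metric space, let $k\geq 2$ be an integer, and let $1\leq p<\infty$ be a real number. The following are equivalent. (1) There are nonempty metric spaces $(P_j,d_j)$ for $1\leq j\leq k$ such that $(X,d)$ is isometric (via a bijective isometry) to the set $P_1\times\cdots\times P_k$ equipped with the $\ell^p$-product metric $$\Big((u_1,\dots,u_k),(v_1,\dots,v_k)\Big)\mapsto\left(\sum_{j=1}^k d_j(u_j,v_j)^p\right)^{1/p}.$$ (2) There are equivalence relations $E_1,\dots,E_k$ on $X$ such that: (a) for each $1\leq j\leq k$, the quotient distance $\bar d_{E_j}$ is a metric on $X/E_j$; (b) for every choice of classes $C_j\in X/E_j$, $1\leq j\leq k$, the intersection $\bigcap_{j=1}^k C_j$ consists of exactly one point; (c) for all $x,y\in X$, $$d(x,y)=\left(\sum_{j=1}^k \bar d_{E_j}([x]_{E_j},[y]_{E_j})^p\right)^{1/p}.$$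
   Context: For an equivalence relation $E$ on a metric space $(X,d)$, $[x]_E$ denotes the $E$-class of $x$, and the quotient distance on $X/E$ is $$\bar d_E([x]_E,[y]_E):=\inf\{d(x',y') : x'\,E\,x,\ y'\,E\,y\}.$$ All metric spaces are nonempty. *)

(* Defs.v *)
From HB Require Import structures.
From mathcomp Require Import all_boot all_order all_algebra.
From mathcomp Require Import all_classical all_reals all_analysis.

Set Implicit Arguments.
Unset Strict Implicit.
Unset Printing Implicit Defensive.

Import Order.TTheory GRing.Theory Num.Theory.

Local Open Scope classical_set_scope.
Local Open Scope ring_scope.
Local Open Scope quotient_scope.

Definition is_metric (R : realType) (T : Type) (d : T -> T -> R) : Prop :=
  [/\ forall x y, 0 <= d x y,
      forall x y, d x y = 0 <-> x = y,
      forall x y, d x y = d y x &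
      forall x y z, d x z <= d x y + d y z].

Definition lp_sum (R : realType) (k : nat) (p : R) (a : 'I_k -> R) : R :=
  (\sum_(j < k) a j `^ p) `^ p^-1.

Definition lp_dist (R : realType) (k : nat) (p : R) (P : 'I_k -> metricType R)
    (u v : forall j, P j) : R :=
  lp_sum p (fun j => mdist (u j) (v j)).

Definition is_isometry (R : realType) (S T : Type) (dS : S -> S -> R)
    (dT : T -> T -> R) (f : S -> T) : Prop :=
  forall x y, dT (f x) (f y) = dS x y.

(* [equiv_rel] is bool-valued; this is no restriction, since the classical axioms
   of boolp make every relation bool-valued. *)
Definition class_set (X : choiceType) (E : equiv_rel X) (c : {eq_quot E}) :
    set X :=
  [set x | \pi_({eq_quot E}) x = c].

Definition quot_dist (R : realType) (X : metricType R) (E : equiv_rel X)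
    (a b : {eq_quot E}) : R :=
  inf [set mdist x y | x in class_set a & y in class_set b].

Lemma class_set_pi (X : choiceType) (E : equiv_rel X) (x : X) :
  class_set (\pi_({eq_quot E}) x) = [set x' | E x' x].
Proof.
by apply/seteqP; split=> x' /=; rewrite /class_set /= => /eqmodP.
Qed.

Lemma quot_dist_pi (R : realType) (X : metricType R) (E : equiv_rel X)
    (x y : X) :
  quot_dist (\pi_({eq_quot E}) x) (\pi_({eq_quot E}) y) =
  inf [set mdist x' y' | x' in [set x' | E x' x] & y' in [set y' | E y' y]].
Proof. by rewrite /quot_dist !class_set_pi. Qed.

(* Main.v *)
Require Import Defs.
From HB Require Import structures.
From mathcomp Require Import all_boot all_order all_algebra.
From mathcomp Require Import all_classical all_reals all_analysis.

Set Implicit Arguments.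
Unset Strict Implicit.
Unset Printing Implicit Defensive.

Import Order.TTheory GRing.Theory Num.Theory.

Local Open Scope classical_set_scope.
Local Open Scope ring_scope.
Local Open Scope quotient_scope.

(** A product has as many equivalence relations as factors: identify the points
with equal [j]-th coordinate.  The quotient distance is an infimum over two
fibers of the [j]-th coordinate map, and in an l^p product this infimum is a
minimum equal to the distance in the factor.  It cannot be smaller because a
coordinate map does not increase distances ([ler_lp_sum]), and it is attained
by replacing the [j]-th coordinate of one point by that of the other, which
leaves a single nonzero term in the l^p sum ([lp_sum_single]).  So each
coordinate map is a submetry, and the quotient of a space by the fibers of a
submetry is isometric to the image ([quot_dist_fiber]).  Properties (a)-(c)
are then those of the coordinates in a product.

Conversely the factors have to be the quotients themselves, with their quotient
distances ([metric_of]); the point [x] goes to the family of its classes.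
Condition (b) says that this map is a bijection and (c) that it is an isometry. *)

(** * The l^p norm of a nonnegative family *)

Lemma ler_lp_sum (R : realType) (k : nat) (p : R) (a : 'I_k -> R) (j : 'I_k) :
  0 < p -> (forall i, 0 <= a i) -> a j <= lp_sum p a.
Proof.
move=> p0 a0; rewrite /lp_sum.
have -> : a j = (a j `^ p) `^ p^-1.
  by rewrite -powRrM mulfV ?gt_eqF// powRr1.
apply: ge0_ler_powR; rewrite ?nnegrE ?invr_ge0 ?powR_ge0 ?(ltW p0)//.
- by apply: sumr_ge0 => i _; exact: powR_ge0.
- by rewrite (bigD1 j)//= lerDl; apply: sumr_ge0 => i _; exact: powR_ge0.
Qed.

Lemma lp_sum_single (R : realType) (k : nat) (p : R) (a : 'I_k -> R)
    (j : 'I_k) :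
  0 < p -> 0 <= a j -> (forall i, i != j -> a i = 0) -> lp_sum p a = a j.
Proof.
move=> p0 aj0 a0; rewrite /lp_sum (bigD1 j)//= big1 ?addr0; last first.
  by move=> i /a0 ->; rewrite powR0// gt_eqF.
by rewrite -powRrM mulfV ?gt_eqF// powRr1.
Qed.

(** * Quotients by the fibers of a submetry *)

Definition fiber_rel (X : Type) (Y : eqType) (g : X -> Y) : rel X :=
  fun x y => g x == g y.

Lemma fiber_equiv_class (X : Type) (Y : eqType) (g : X -> Y) :
  equiv_class_of (fiber_rel g).
Proof.
split=> [x|x y|y x z]; rewrite /fiber_rel ?eqxx //.
by move=> /eqP -> /eqP ->.
Qed.

Definition fiber (X : Type) (Y : eqType) (g : X -> Y) : equiv_rel X :=
  EquivRelPack (fiber_equiv_class g).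

Lemma eq_pi_fiber (X : choiceType) (Y : eqType) (g : X -> Y) (x y : X) :
  \pi_({eq_quot (fiber g)}) x = \pi_({eq_quot (fiber g)}) y <-> g x = g y.
Proof.
split=> [/eqmodP/eqP//|gxy]; apply/eqmodP.
by rewrite /= /fiber_rel gxy eqxx.
Qed.

(** The map does not increase distances, and each point of the image is reached
along an optimal segment from any given [x]; it need not be surjective. *)
Definition is_submetry (R : realType) (X Y : metricType R) (g : X -> Y) :=
  (forall x y, mdist (g x) (g y) <= mdist x y) /\
  (forall x y, exists2 y', g y' = g y & mdist x y' = mdist (g x) (g y)).

(** The first half of [is_submetry] bounds all distances between two fibers from
below by the distance of the images; the second half realizes the bound. *)
Lemma quot_dist_fiber (R : realType) (X Y : metricType R) (g : X -> Y)
    (x y : X) : is_submetry g ->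
  quot_dist (\pi_({eq_quot (fiber g)}) x) (\pi_({eq_quot (fiber g)}) y) =
  mdist (g x) (g y).
Proof.
move=> [g_le g_lift]; rewrite quot_dist_pi.
set D := [set _ | _ in _ & _ in _].
have lbD : lbound D (mdist (g x) (g y)).
  by move=> _ [x' /eqP gx'] [y' /eqP gy'] <-; rewrite -gx' -gy'; exact: g_le.
have Dxy : D (mdist (g x) (g y)).
  have [y' gy' <-] := g_lift x y.
  by exists x; [exact/eqP | exists y' => //; exact/eqP].
apply/le_anti/andP; split.
- by apply: ge_inf => //; exists (mdist (g x) (g y)).
- by apply: lb_le_inf => //; exists (mdist (g x) (g y)).
Qed.

Lemma quot_dist_fiber_metric (R : realType) (X Y : metricType R) (g : X -> Y) :
  is_submetry g -> is_metric (@quot_dist R X (fiber g)).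
Proof.
move=> gS; split.
- by elim/quotW=> x; elim/quotW=> y; rewrite quot_dist_fiber// mdist_ge0.
- elim/quotW=> x; elim/quotW=> y; rewrite quot_dist_fiber// eq_pi_fiber.
  by split=> [/mdist_positivity//|->]; rewrite mdistxx.
- elim/quotW=> x; elim/quotW=> y.
  by rewrite !quot_dist_fiber// metric_sym.
- elim/quotW=> x; elim/quotW=> y; elim/quotW=> z.
  by rewrite !quot_dist_fiber// metric_triangle.
Qed.

(** * Coordinates of an l^p product *)

Section coordinates.
Context (R : realType) (X : metricType R) (k : nat) (p : R).
Variables (P : 'I_k -> metricType R) (f : X -> forall j, P j).
Hypotheses (p_gt0 : 0 < p) (f_bij : bijective f).
Hypothesis f_iso : is_isometry mdist (@lp_dist R k p P) f.

Lemma coord_submetry (j : 'I_k) : is_submetry (fun x => f x j).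
Proof.
have [h hK fK] := f_bij; split=> x y.
  rewrite -f_iso; apply: (@ler_lp_sum R k p (fun i => mdist (f x i) (f y i))).
    exact: p_gt0.
  by move=> i; exact: mdist_ge0.
(* f x with its j-th coordinate replaced by that of f y *)
pose v := dfwith (f x) j (f y j).
exists (h v); first by rewrite fK /v dfwithin.
rewrite -f_iso fK /lp_dist.
rewrite (lp_sum_single (j := j) p_gt0) ?mdist_ge0//.
  by rewrite /v dfwithin.
by move=> i ij; rewrite /v dfwithout 1?eq_sym// mdistxx.
Qed.

Lemma coord_bigcap_class
    (C : forall j, {eq_quot (fiber (fun x => f x j))}) :
  exists x, \bigcap_(j in [set: 'I_k]) class_set (C j) = [set x].
Proof.
have [h hK fK] := f_bij; exists (h (fun j => f (repr (C j)) j)).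
apply/seteqP; split=> [x Cx|_ -> j _] /=.
  rewrite -[LHS]hK; congr h; apply: functional_extensionality_dep => j.
  apply/(eq_pi_fiber (fun x => f x j)); rewrite reprK; exact: Cx.
by rewrite /class_set /= -[RHS]reprK; apply/eq_pi_fiber; rewrite fK.
Qed.

End coordinates.

(** * Metric spaces given by a distance function *)

(** The proof that [d] is a metric is an argument of this copy of [M] because
instance inference sees only the type: a quotient [{eq_quot E}] does not
determine a distance, nor does it satisfy the axioms of one in general. *)
Definition metric_of (R : realType) (M : choiceType) (d : M -> M -> R)
  (_ : is_metric d) : Type := M.

Section metric_of.
Context (R : realType) (M : choiceType) (d : M -> M -> R) (dM : is_metric d).

Let d_refl x : d x x = 0. Proof. by have [_ /(_ x x)[_ ->]] := dM. Qed.
Let d_pos x y : d x y = 0 -> x = y. Proof. by have [_ /(_ x y)[]] := dM. Qed.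
Let d_sym x y : d x y = d y x. Proof. by have [_ _ ->] := dM. Qed.
Let d_triangle y x z : d x z <= d x y + d y z. Proof. by have [_ _ _] := dM. Qed.

HB.instance Definition _ := Choice.on (metric_of dM).
HB.instance Definition _ :=
  isMetric.Build R (metric_of dM) d_refl d_pos d_sym d_triangle.

End metric_of.

(** Choosing the common point of each family of classes gives the inverse map:
existence of that point makes the map surjective, uniqueness injective. *)
Lemma classes_bij (X : choiceType) (I : Type) (E : I -> equiv_rel X) :
  (forall C : (forall j, {eq_quot (E j)}),
    exists x, \bigcap_(j in [set: I]) class_set (C j) = [set x]) ->
  bijective (fun x j => \pi_({eq_quot (E j)}) x).
Proof.
move=> /choice[h hE].
have hK C j : \pi_({eq_quot (E j)}) (h C) = C j.
  have : [set h C] (h C) by [].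
  by rewrite -hE; apply.
exists h => [x|C]; last first.
  by apply: functional_extensionality_dep => j; exact: hK.
by apply/esym; rewrite -[_ = _]/([set _] x) -hE.
Qed.

(** * The characterization of l^p products *)

Theorem theorem1p1 (R : realType) (X : metricType R) (k : nat) (p : R)
    (X_neq0 : [set: X] !=set0) (k_ge2 : (2 <= k)%N) (p_ge1 : 1 <= p) :
  (exists P : 'I_k -> metricType R,
     (forall j, [set: P j] !=set0) /\
     exists f : X -> (forall j, P j),
       bijective f /\ is_isometry mdist (@lp_dist R k p P) f)
  <->
  (exists E : 'I_k -> equiv_rel X,
     [/\ forall j, is_metric (@quot_dist R X (E j)),
         forall C : (forall j, {eq_quot (E j)}),
           exists x : X, \bigcap_(j in [set: 'I_k]) class_set (C j) = [set x] &
         forall x y : X,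
           mdist x y =
           lp_sum p (fun j => quot_dist (\pi_({eq_quot (E j)}) x)
                                        (\pi_({eq_quot (E j)}) y))]).
Proof.
have p_gt0 : 0 < p := lt_le_trans ltr01 p_ge1.
split=> [[P [_ [f [f_bij f_iso]]]]|[E [dE EI Ed]]].
  exists (fun j => fiber (fun x => f x j)).
  have fS := coord_submetry p_gt0 f_bij f_iso.
  split=> [j|C|x y]; first exact: quot_dist_fiber_metric.
    exact: coord_bigcap_class.
  rewrite -f_iso /lp_dist; congr lp_sum.
  by apply/funext => j; rewrite quot_dist_fiber.
exists (fun j => metric_of (dE j)); split.
  by move=> j; have [x _] := X_neq0; exists (\pi_({eq_quot (E j)}) x).
exists (fun x j => \pi_({eq_quot (E j)}) x); split; first exact: classes_bij.
by move=> x y; rewrite Ed.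
Qed.
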